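(* For all integers $n\geq 0$, \[ \sigma_e\mathrm{mex}(10n+6)\equiv 0 \pmod{4}\qquad\text{and}\qquad \sigma_e\mathrm{mex}(10n+8)\equiv 0 \pmod{4}. \]
   Context: A partition of a nonnegative integer $n$ is a non-increasing sequence of positive integers (parts) summing to $n$; $\mathcal{P}(n)$ denotes the set of partitions of $n$. The minimal excludant $\mathrm{mex}(\pi)$ of a partition $\pi$ is the least positive integer that is not a part of $\pi$. Define $\sigma_e\mathrm{mex}(n):=\sum_{\pi\in\mathcal{P}(n),\ 2\mid \mathrm{mex}(\pi)}\mathrm{mex}(\pi)$, the sum of the even minimal excludants over all partitions of $n$. *)

(* Defs.v *)
From mathcomp Require Import all_boot.

Set Implicit Arguments.
Unset Strict Implicit.
Unset Printing Implicit Defensive.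

Definition is_partition (n : nat) (s : seq nat) : bool :=
  [&& sorted geq s, all (leq 1) s & sumn s == n].

(* The parts of a partition of n are at most n, and so is their number, so the
   partitions of n are found among the sequences of length at most n over 'I_n.+1;
   mem_partitions and partitions_uniq below show that nothing is lost or
   repeated. *)
Definition partitions (n : nat) : seq (seq nat) :=
  [seq s <- [seq map val (b : seq 'I_n.+1) | b : n.-bseq 'I_n.+1]
     | is_partition n s].

Lemma mem_partitions (n : nat) (s : seq nat) :
  (s \in partitions n) = is_partition n s.
Proof.
rewrite mem_filter; case: (boolP (is_partition n s)) => //= /and3P[_ pos /eqP sn].
have szs : size s <= n.
  rewrite -sn; elim: s pos {sn} => //= x s IHs /andP[x0 /IHs szs].
  by rewrite -add1n leq_add.
have les : all (fun x => x < n.+1) s.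
  apply/allP=> x xs; rewrite ltnS -sn sumnE (big_rem x xs) /=; exact: leq_addr.
have szi : size (map (@inord n) s) <= n by rewrite size_map.
apply/mapP; exists (Bseq szi); first by rewrite mem_enum.
rewrite /= -map_comp -[LHS]map_id; apply/eq_in_map => x xs /=.
by rewrite inordK //; move/allP: les; exact.
Qed.

Lemma partitions_uniq (n : nat) : uniq (partitions n).
Proof.
apply: filter_uniq; rewrite map_inj_uniq ?enum_uniq // => b c /= eq_bc.
by apply/val_inj/(inj_map val_inj).
Qed.

Lemma mex_exists (s : seq nat) : exists m, (0 < m) && (m \notin s).
Proof.
exists (sumn s).+1; apply/negP => ss.
have : (sumn s).+1 <= sumn s by rewrite {2}sumnE (big_rem _ ss) leq_addr.
by rewrite ltnn.
Qed.

Definition mex (s : seq nat) : nat := ex_minn (mex_exists s).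

Definition sigma_e_mex (n : nat) : nat :=
  \sum_(p <- partitions n | 2 %| mex p) mex p.

(* Main.v *)
Require Import Defs.
From mathcomp Require Import all_boot all_algebra zify ring.

(** Write E = prod_(i >= 1) (1 - q^i), P = 1 / E and psi = sum_m q^(m(m+1)/2).
    Since P(q) q^(m(m+1)/2) counts the partitions with mex > m, half of the sum
    of the even mex's has the parity of the coefficients of P psi_o, where psi_o
    collects the odd powers of psi.  Gauss's theorem E psi = E(q^2)^2 reads
    psi = E^3 modulo 2.  Hence P = psi P^4 with P^4 even, so the even part of
    P psi_o is (psi_o P^2)^2, and psi_o P^2 is the odd part of psi P^2 = E.  By
    Euler's theorem the coefficient at q^(2m) therefore vanishes unless m is a
    generalized pentagonal number, and none of these is 3 or 4 modulo 5.

    The theorems of Euler and Gauss are taken in Shanks's finite forms, which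
    are polynomial identities proved by telescoping. *)

Set Implicit Arguments.
Unset Strict Implicit.
Unset Printing Implicit Defensive.
Import GRing.Theory.

Definition triangular (n : nat) : nat := 'C(n.+1, 2).

Lemma triangularS n : triangular n.+1 = triangular n + n.+1.
Proof. by rewrite /triangular binS bin1. Qed.

Lemma double_triangular n : (triangular n).*2 = n * n.+1.
Proof. by elim: n => // n IHn; rewrite triangularS doubleD IHn; lia. Qed.

Lemma odd_triangular n : odd (triangular n) = (n %% 4 == 1) || (n %% 4 == 2).
Proof.
elim/ltn_ind: n => -[|[|[|[|n]]]] // IHn.
have -> : triangular n.+4 = triangular n + (2 * n + 5).*2.
  by rewrite !triangularS; lia.
by rewrite oddD odd_double addbF IHn; lia.
Qed.

Lemma sum_odd_triangular_mod4 n :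
  2 * \sum_(m < n | odd (triangular m)) 1 = (if 2 %| n then n else 0) %[mod 4].
Proof.
elim: n => [|n IHn]; first by rewrite big_ord0.
rewrite big_mkcond big_ord_recr -big_mkcond /= odd_triangular mulnDr.
by move: (\sum_(_ < n | _) _) IHn => S; do ?case: ifP => ?; lia.
Qed.

(* These are the numbers k (3 k - 1) / 2 and k (3 k + 1) / 2; k = 0 gives 0. *)
Definition generalized_pentagonal (n : nat) : Prop :=
  exists k, n = k ^ 2 + triangular k.-1 \/ n = k ^ 2 + triangular k.

Lemma generalized_pentagonal_mod5 n : generalized_pentagonal n -> n %% 5 < 3.
Proof.
have residue k t : 2 * t = k * k.+1 ->
    (k ^ 2 + t) %% 5 < 3 /\ (k.+1 ^ 2 + t) %% 5 < 3.
  rewrite (divn_eq k 5); have := ltn_pmod k (isT : 0 < 5).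
  move: (k %/ 5) (k %% 5) => x y.
  by case: y => [|[|[|[|[|//]]]]] _; set w := x * 5; split; nia.
have tri k : 2 * triangular k = k * k.+1 by rewrite mul2n double_triangular.
case=> -[|k] [] -> //; first by case: (residue _ _ (tri k)).
by case: (residue _ _ (tri k.+1)).
Qed.

Lemma geq_trans : transitive geq.
Proof. exact: rev_trans leq_trans. Qed.

Lemma geq_anti : antisymmetric geq.
Proof. by move=> x y /= /andP[yx xy]; apply/eqP; rewrite eqn_leq xy yx. Qed.

Lemma geq_total : total geq.
Proof. by move=> x y; apply: leq_total. Qed.

Section Partitions.

Implicit Types (s t : seq nat) (j k m n : nat).

Lemma partition_perm_eq n s t :
  is_partition n s -> is_partition n t -> perm_eq s t -> s = t.
Proof.
move=> /and3P[s_sorted _ _] /and3P[t_sorted _ _].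
exact: sorted_eq geq_trans geq_anti _ _ s_sorted t_sorted.
Qed.

Lemma partition_rem n j s :
  is_partition n s -> j \in s -> is_partition (n - j) (rem j s).
Proof.
move=> /and3P[s_sorted s_pos /eqP sn] js; apply/and3P; split.
- exact: (subseq_sorted geq_trans (rem_subseq j s)).
- by apply/allP => x /mem_rem; apply: (allP s_pos).
- by rewrite -sn (perm_sumn (perm_to_rem js)) /= addKn.
Qed.

Lemma partition_insert n j s : 0 < j ->
  is_partition n s -> is_partition (j + n) (sort geq (j :: s)).
Proof.
move=> j_gt0 /and3P[s_sorted s_pos /eqP sn].
have sort_perm : perm_eq (sort geq (j :: s)) (j :: s) by rewrite perm_sort.
apply/and3P; split; first exact: sort_sorted geq_total _.
- by rewrite (perm_all _ sort_perm) /= j_gt0.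
- by rewrite (perm_sumn sort_perm) /= sn.
Qed.

Lemma part_leq n j s : is_partition n s -> j \in s -> j <= n.
Proof.
by move=> /and3P[_ _ /eqP <-] js; rewrite (perm_sumn (perm_to_rem js)) leq_addr.
Qed.

Lemma perm_partitions_rem n j : 0 < j <= n ->
  perm_eq [seq rem j s | s <- partitions n & j \in s] (partitions (n - j)).
Proof.
move=> /andP[j_gt0 le_jn]; apply: uniq_perm; last 1 first.
- move=> s; rewrite mem_partitions; apply/mapP/idP => [[t]|s_part].
    rewrite mem_filter mem_partitions => /andP[jt t_part] ->.
    exact: partition_rem.
  have sort_perm : perm_eq (sort geq (j :: s)) (j :: s) by rewrite perm_sort.
  have sort_part : is_partition n (sort geq (j :: s)).
    by rewrite -(subnKC le_jn) partition_insert.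
  have j_sort : j \in sort geq (j :: s) by rewrite mem_sort mem_head.
  exists (sort geq (j :: s)); first by rewrite mem_filter j_sort mem_partitions.
  apply: partition_perm_eq s_part (partition_rem sort_part j_sort) _.
  by rewrite -(perm_cons j) -(permPr (perm_to_rem j_sort)) perm_sym.
- rewrite map_inj_in_uniq; first exact/filter_uniq/partitions_uniq.
  move=> s t; rewrite mem_filter mem_partitions => /andP[js s_part].
  rewrite mem_filter mem_partitions => /andP[jt t_part] eq_rem.
  apply: partition_perm_eq s_part t_part _.
  by rewrite (permPr (perm_to_rem jt)) -eq_rem perm_to_rem.
- exact: partitions_uniq.
Qed.

Lemma count_partitions_rem (A : pred (seq nat)) n j : 0 < j ->
  count (fun s => (j \in s) && A (rem j s)) (partitions n) =
  if j <= n then count A (partitions (n - j)) else 0.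
Proof.
move=> j_gt0; case: leqP => [le_jn|lt_nj].
  have rem_perm := @perm_partitions_rem n j.
  rewrite -(permP (rem_perm _)) ?j_gt0 // count_map [RHS]count_filter.
  by apply: eq_count => s /=; rewrite andbC.
apply/eqP; rewrite -leqn0 leqNgt -has_count; apply/hasPn => s.
rewrite mem_partitions => s_part; apply: contraTN lt_nj => /andP[js _].
by rewrite -leqNgt (part_leq s_part).
Qed.

Definition partition_number n : nat := size (partitions n).

Definition bounded_partition_number k n : nat :=
  count (all (geq k)) (partitions n).

Lemma bounded_partition_number0 n : bounded_partition_number 0 n = (n == 0).
Proof.
have -> : bounded_partition_number 0 n = count_mem [::] (partitions n).
  apply: eq_in_count => s; rewrite mem_partitions => /and3P[_ s_pos _].
  by case: s s_pos => //= x s /andP[x_gt0 _]; rewrite leqNgt x_gt0.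
rewrite count_uniq_mem ?partitions_uniq // mem_partitions.
by rewrite /is_partition eq_sym.
Qed.

Lemma all_geqS k s : all (geq k) s = (k.+1 \notin s) && all (geq k.+1) s.
Proof.
elim: s => //= x s ->; rewrite inE.
by case: (k.+1 \in s); rewrite ?orbT ?andbF //= orbF; lia.
Qed.

Lemma bounded_partition_numberS k n :
  bounded_partition_number k.+1 n =
  bounded_partition_number k n +
  (if k < n then bounded_partition_number k.+1 (n - k.+1) else 0).
Proof.
rewrite -count_partitions_rem // /bounded_partition_number.
move: (partitions n) => parts.
rewrite -size_filter -(count_predC (fun s => k.+1 \in s)) !count_filter addnC.
congr (_ + _); apply: eq_count => s /=; first by rewrite [RHS]all_geqS.
by case ks: (k.+1 \in s) => //=; rewrite (perm_all _ (perm_to_rem ks)) /= leqnn.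
Qed.

Lemma bounded_partition_number_full k n : n <= k ->
  bounded_partition_number k n = partition_number n.
Proof.
move=> le_nk; rewrite /bounded_partition_number /partition_number -count_predT.
apply: eq_in_count => s; rewrite mem_partitions => s_part.
by apply/allP => j /(part_leq s_part) le_jn; apply: leq_trans le_nk.
Qed.

Lemma ltn_mexE m s : (m < mex s) = all (fun j => j \in s) (iota 1 m).
Proof.
rewrite /mex; case: ex_minnP => x /andP[x_gt0 xs] x_min.
apply/idP/allP => [lt_mx j|m_in].
  rewrite mem_iota => /andP[j_gt0 lt_jm]; apply: contraT => js.
  have := x_min j; rewrite j_gt0 js => /(_ isT); lia.
rewrite ltnNge; apply: contra xs => le_xm; apply: m_in.
by rewrite mem_iota x_gt0.
Qed.

Lemma ltn_mexS_rem m s :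
  (m.+1 < mex s) = (m.+1 \in s) && (m < mex (rem m.+1 s)).
Proof.
rewrite !ltn_mexE -[X in iota 1 X]addn1 iotaD all_cat /= add1n andbT andbC.
case ms: (m.+1 \in s) => //=; apply: eq_in_all => j.
rewrite mem_iota => /andP[_ lt_jm]; rewrite (perm_mem (perm_to_rem ms)) inE.
by rewrite ltn_eqF.
Qed.

Lemma mex_leqS n s : is_partition n s -> mex s <= n.+1.
Proof.
move=> s_part; rewrite leqNgt ltn_mexE; apply/negP => /allP/(_ n.+1).
by rewrite mem_iota ltnSn => /(_ isT)/(part_leq s_part); rewrite ltnn.
Qed.

(* Removing one part of each size 1, ..., m leaves an arbitrary partition. *)
Lemma count_ltn_mex m n :
  count (fun s => m < mex s) (partitions n) =
  if triangular m <= n then partition_number (n - triangular m) else 0.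
Proof.
elim: m n => [|m IHm] n.
  by rewrite subn0 -[RHS]count_predT; apply: eq_count => s; rewrite ltn_mexE.
rewrite (eq_count (ltn_mexS_rem m)) triangularS addnC.
rewrite (count_partitions_rem (fun s => m < mex s)) //.
case: ltnP => [lt_mn|le_nm]; first by rewrite IHm leq_subRL // subnDA.
by rewrite leqNgt (leq_ltn_trans le_nm) // ltnS leq_addr.
Qed.

Lemma sum_ltn_mex (Q : pred nat) n K : n < K ->
  \sum_(s <- partitions n) \sum_(m < mex s | Q m) 1 =
  \sum_(m < K | Q m)
    (if triangular m <= n then partition_number (n - triangular m) else 0).
Proof.
move=> lt_nK.
under [RHS]eq_bigr => m _ do rewrite -count_ltn_mex -sum1_count big_mkcond.
rewrite exchange_big /= big_seq [RHS]big_seq; apply: eq_bigr => s.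
rewrite mem_partitions => /mex_leqS le_mexn; rewrite -big_mkcondr.
exact: (big_ord_widen_cond _ Q (fun=> 1)) (leq_trans le_mexn lt_nK).
Qed.

Lemma sigma_e_mex_mod4 n K : n < K ->
  sigma_e_mex n =
  2 * \sum_(m < K | odd (triangular m))
        (if triangular m <= n then partition_number (n - triangular m) else 0)
  %[mod 4].
Proof.
move=> lt_nK; rewrite -(sum_ltn_mex (fun m => odd (triangular m)) lt_nK).
rewrite big_distrr /sigma_e_mex big_mkcond -modn_summ -[RHS]modn_summ.
by under eq_bigr => s _ do rewrite -sum_odd_triangular_mod4.
Qed.

End Partitions.

Local Open Scope ring_scope.

Section QPochhammer.

Variables (R : comNzRingType) (q : R).
Implicit Types (m n s : nat).

(* The q-shifted factorial (q^(m+1); q)_(n-m). *)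
Definition qpoch m n : R := \prod_(m <= i < n) (1 - q ^+ i.+1).

Lemma qpochnn n : qpoch n n = 1.
Proof. by rewrite /qpoch big_geq. Qed.

Lemma qpoch_recl m n : (m < n)%N -> qpoch m n = (1 - q ^+ m.+1) * qpoch m.+1 n.
Proof. exact: big_ltn. Qed.

Lemma qpoch_recr m n : (m <= n)%N -> qpoch m n.+1 = qpoch m n * (1 - q ^+ n.+1).
Proof. exact: big_nat_recr. Qed.

Lemma qpoch_cat m n p : (m <= n <= p)%N -> qpoch m p = qpoch m n * qpoch n p.
Proof. by case/andP => le_mn le_np; apply: big_cat_nat. Qed.

Lemma finite_euler_pentagonal n :
  \sum_(0 <= s < n.+1) (-1) ^+ s * qpoch s n * q ^+ (s * n + triangular s) =
  1 + \sum_(0 <= k < n) (-1) ^+ k.+1 *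
        (q ^+ (k.+1 ^ 2 + triangular k) + q ^+ (k.+1 ^ 2 + triangular k.+1)).
Proof.
elim: n => [|n IHn]; first by rewrite !big_nat1 big_geq // qpochnn !mul1r addr0.
rewrite [X in 1 + X]big_nat_recr //= addrA -{}IHn.
pose t s := (-1) ^+ s * qpoch s n * q ^+ (s * n + triangular s).
have telescope : \sum_(0 <= s < n)
    ((-1) ^+ s * qpoch s n.+1 * q ^+ (s * n.+1 + triangular s) - t s) =
    t n * (1 - q ^+ n) - t 0 * (1 - q ^+ 0).
  apply: (telescope_sumr_eq (fun s => t s * (1 - q ^+ s))) => //.
  move=> s /andP[_ lt_sn].
  rewrite /t qpoch_recr ?(ltnW lt_sn) // (qpoch_recl lt_sn) triangularS.
  by rewrite mulnS mulSn !(exprD, exprS); ring.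
move/eqP: telescope; rewrite sumrB subr_eq => /eqP telescope.
rewrite 2?big_nat_recr //= telescope [X in _ = X + _]big_nat_recr //= -/(t n).
rewrite /t !qpochnn qpoch_recr // qpochnn triangularS.
rewrite (_ : n.+1 ^ 2 = n * n + n + n + 1)%N; last lia.
by rewrite !mulnS !mulSn !(exprD, exprS); ring.
Qed.

Definition odd_qpoch n : R := \prod_(0 <= i < n) (1 - q ^+ i.*2.+1).

Lemma odd_qpoch_recr n : odd_qpoch n.+1 = odd_qpoch n * (1 - q ^+ n.*2.+1).
Proof. exact: big_nat_recr. Qed.

End QPochhammer.

Section FiniteGauss.

Variables (R : comNzRingType) (q : R).

Lemma odd_qpoch_mul n : odd_qpoch q n * qpoch (q ^+ 2) 0 n = qpoch q 0 n.*2.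
Proof.
elim: n => [|n IHn]; first by rewrite /odd_qpoch big_geq // !qpochnn mul1r.
rewrite odd_qpoch_recr doubleS !qpoch_recr // -IHn -exprM mul2n doubleS; ring.
Qed.

Lemma finite_gauss_triangular n :
  odd_qpoch q n * \sum_(0 <= m < n.*2) q ^+ triangular m =
  \sum_(0 <= s < n) odd_qpoch q s * qpoch (q ^+ 2) s n * q ^+ (s * n.*2.+1).
Proof.
elim: n => [|n IHn]; first by rewrite !big_geq ?mulr0.
pose t s := odd_qpoch q s * qpoch (q ^+ 2) s n * q ^+ (s * n.*2.+1).
have telescope : \sum_(0 <= s < n)
    (odd_qpoch q s * qpoch (q ^+ 2) s n.+1 * q ^+ (s * n.+1.*2.+1) -
     (1 - q ^+ n.*2.+1) * t s) =
    t n * (1 - q ^+ n.*2) - t 0 * (1 - q ^+ 0.*2).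
  apply: (telescope_sumr_eq (fun s => t s * (1 - q ^+ s.*2))) => //.
  move=> s /andP[_ lt_sn].
  rewrite /t odd_qpoch_recr qpoch_recr ?(ltnW lt_sn) // (qpoch_recl _ lt_sn).
  rewrite -!exprM !mul2n !doubleS -!addnn !mulnS !mulSn !(exprD, exprS); ring.
move/eqP: telescope; rewrite sumrB -mulr_sumr -IHn subr_eq => /eqP telescope.
rewrite [RHS]big_nat_recr //= telescope doubleS 2?big_nat_recr //= /t.
rewrite odd_qpoch_recr qpoch_recr // !qpochnn.
have tri_n : triangular n.*2 = (n * n.*2.+1)%N.
  by have := double_triangular n.*2; lia.
rewrite triangularS tri_n -!exprM !mul2n !doubleS -!addnn !mulnS.
rewrite !(exprD, exprS); ring.
Qed.

End FiniteGauss.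

Section TruncatedPolynomials.

Variable R : comNzRingType.
Implicit Types (p u v : {poly R}) (m n i : nat).

Definition eqmodX n p u : Prop := forall i, (i < n)%N -> p`_i = u`_i.

Lemma eqmodX_sym n p u : eqmodX n p u -> eqmodX n u p.
Proof. by move=> pu i /pu. Qed.

Lemma eqmodX_trans n p u v : eqmodX n p u -> eqmodX n u v -> eqmodX n p v.
Proof. by move=> pu uv i lt_in; rewrite pu ?uv. Qed.

Lemma eqmodX_leq m n p u : (m <= n)%N -> eqmodX n p u -> eqmodX m p u.
Proof. by move=> le_mn pu i lt_im; apply/pu/(leq_trans lt_im). Qed.

Lemma eqmodXD n p1 u1 p2 u2 :
  eqmodX n p1 u1 -> eqmodX n p2 u2 -> eqmodX n (p1 + p2) (u1 + u2).
Proof. by move=> pu1 pu2 i lt_in; rewrite !coefD pu1 ?pu2. Qed.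

Lemma eqmodXM n p1 u1 p2 u2 :
  eqmodX n p1 u1 -> eqmodX n p2 u2 -> eqmodX n (p1 * p2) (u1 * u2).
Proof.
move=> pu1 pu2 i lt_in; rewrite !coefM; apply: eq_bigr => j _.
by rewrite pu1 ?pu2 //; apply: leq_ltn_trans lt_in; rewrite ?leq_subr -1?ltnS.
Qed.

Lemma eqmodXMl n p u v : eqmodX n u v -> eqmodX n (p * u) (p * v).
Proof. exact: eqmodXM. Qed.

Lemma eqmodXMr n p u v : eqmodX n u v -> eqmodX n (u * p) (v * p).
Proof. by move/eqmodXM; apply. Qed.

Lemma eqmodX_exp n k p u : eqmodX n p u -> eqmodX n (p ^+ k) (u ^+ k).
Proof. by move=> pu; elim: k => // k IHk; rewrite !exprS; apply: eqmodXM. Qed.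

Lemma eqmodX_mul_exp1 n k p u : eqmodX n u 1 -> eqmodX n (p * u ^+ k) p.
Proof.
move=> u1; rewrite -[X in eqmodX _ _ X]mulr1 -(expr1n _ k).
exact/eqmodXMl/eqmodX_exp.
Qed.

Lemma eqmodX_mulXn n k p : (n <= k)%N -> eqmodX n (p * 'X^k) 0.
Proof.
by move=> le_nk i lt_in; rewrite coefMXn (leq_trans lt_in le_nk) coef0.
Qed.

Lemma eqmodX_sum0 n a b (f : nat -> {poly R}) :
  (forall i, (a <= i < b)%N -> eqmodX n (f i) 0) ->
  eqmodX n (\sum_(a <= i < b) f i) 0.
Proof.
move=> f0; rewrite big_nat; elim/big_ind: _ => // p u p0 u0.
by rewrite -[0]addr0; apply: eqmodXD.
Qed.

End TruncatedPolynomials.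

Section EulerProduct.

Variable R : comNzRingType.
Implicit Types (k m n r : nat).

Definition euler n : {poly R} := qpoch 'X 0 n.

Lemma eqmodX_qpochX m n : eqmodX m.+1 (qpoch ('X : {poly R}) m n) 1.
Proof.
rewrite /qpoch big_nat; elim/big_ind: _ => // [p u p1 u1 | i /andP[le_mi _]].
  by rewrite -[1]mulr1; apply: eqmodXM.
rewrite -[X in eqmodX _ _ X]subr0 -[X in 1 - X]mul1r.
by move=> j lt_jm; rewrite !coefB; congr (_ - _); apply: eqmodX_mulXn lt_jm.
Qed.

Lemma euler_stable r n : (r <= n)%N -> eqmodX r.+1 (euler n) (euler r).
Proof.
move=> le_rn; rewrite /euler (@qpoch_cat _ _ 0 r) // -[X in eqmodX _ _ X]mulr1.
exact/eqmodXMl/eqmodX_qpochX.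
Qed.

Lemma euler_pentagonal n :
  eqmodX n.+1 (euler n)
    (1 + \sum_(0 <= k < n) (-1) ^+ k.+1 *
           ('X^(k.+1 ^ 2 + triangular k) + 'X^(k.+1 ^ 2 + triangular k.+1))).
Proof.
rewrite -finite_euler_pentagonal big_ltn // expr0 mul1r mul0n mulr1.
rewrite -[X in eqmodX _ X _]addr0.
apply: eqmodXD => //; apply/eqmodX_sym/eqmodX_sum0 => -[|s] // /andP[_ lt_sn].
by apply: eqmodX_mulXn; rewrite triangularS; lia.
Qed.

Lemma coef_euler_eq0 m n :
  (m <= n)%N -> ~ generalized_pentagonal m -> (euler n)`_m = 0.
Proof.
move=> le_mn m_pent; rewrite (euler_pentagonal le_mn) coefD coef1 coef_sum big1.
  by rewrite addr0; case: eqP => // m0; case: m_pent; exists 0%N; left.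
move=> k _; have X_m0 e : m <> e -> 'X^e`_m = 0 :> R.
  by move/eqP; rewrite coefXn => /negbTE->.
rewrite -(rmorph_sign polyC) mul_polyC coefZ coefD !X_m0 ?addr0 ?mulr0 //.
  by move=> def_m; apply: m_pent; exists k.+1; right.
by move=> def_m; apply: m_pent; exists k.+1; left.
Qed.

Lemma euler_mul_triangular n : (0 < n)%N ->
  eqmodX n.*2.+1 (euler n.*2 * \sum_(0 <= m < n.*2) 'X^(triangular m))
    (qpoch 'X^2 0 n ^+ 2).
Proof.
move=> n_gt0; rewrite /euler -odd_qpoch_mul mulrAC finite_gauss_triangular.
rewrite big_ltn // /odd_qpoch big_geq // mul1r mul0n mulr1 expr2.
apply: eqmodXMr; rewrite -[X in eqmodX _ _ X]addr0; apply: eqmodXD => //.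
apply: eqmodX_sum0 => s /andP[s_gt0 _].
by apply: eqmodX_mulXn; rewrite leq_pmull.
Qed.

Definition bounded_partition_series k N : {poly R} :=
  \poly_(n < N) (bounded_partition_number k n)%:R.

Definition partition_series N : {poly R} :=
  \poly_(n < N) (partition_number n)%:R.

Lemma euler_mul_bounded_partition_series k N :
  eqmodX N (euler k * bounded_partition_series k N) 1.
Proof.
elim: k => [|k IHk].
  rewrite /euler qpochnn mul1r => n lt_nN.
  by rewrite coef_poly lt_nN bounded_partition_number0 coef1.
rewrite /euler qpoch_recr // -mulrA; apply: eqmodX_trans IHk; apply: eqmodXMl.
move=> n lt_nN; rewrite mulrC mulrBr mulr1 coefB coefMXn !coef_poly lt_nN.
rewrite (leq_ltn_trans (leq_subr _ _) lt_nN) bounded_partition_numberS.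
rewrite natrD ltnS.
by case: leqP => _; rewrite addrK // subr0.
Qed.

Lemma euler_mul_partition_series N :
  eqmodX N (euler N * partition_series N) 1.
Proof.
suff -> : partition_series N = bounded_partition_series N N.
  exact: euler_mul_bounded_partition_series.
apply/polyP => n; rewrite !coef_poly; case: ltnP => // lt_nN.
by rewrite bounded_partition_number_full // ltnW.
Qed.

End EulerProduct.

Section Parity.

Variable R : comNzRingType.
Implicit Types (p : {poly R}) (b : bool).

Definition has_parity b p : Prop := forall i, odd i != b -> p`_i = 0.

Lemma has_parityM b1 b2 p1 p2 :
  has_parity b1 p1 -> has_parity b2 p2 -> has_parity (b1 (+) b2) (p1 * p2).
Proof.
move=> par1 par2 i odd_i; rewrite coefM big1 // => j _.
have [odd_j | /par1 ->] := eqVneq (odd j) b1; last by rewrite mul0r.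
rewrite [X in _ * X]par2 ?mulr0 // oddB -1?ltnS // odd_j.
by apply: contraNneq odd_i => <-; rewrite addbCA addbb addbF.
Qed.

Lemma has_parity_sum_Xn b (I : finType) (Q : pred I) (e : I -> nat) :
  (forall i, Q i -> odd (e i) = b) -> has_parity b (\sum_(i | Q i) 'X^(e i)).
Proof.
move=> Qb i odd_i; rewrite coef_sum big1 // => j /Qb odd_e; rewrite coefXn.
by case: (i =P e j) odd_i => // ->; rewrite odd_e eqxx.
Qed.

End Parity.

Section CharacteristicTwo.

Variable R : comNzRingType.
Hypothesis char2 : 2 \in [pchar R].

Lemma sqrD_pchar2 (x y : R) : (x + y) ^+ 2 = x ^+ 2 + y ^+ 2.
Proof. by rewrite sqrrD mulrn_pchar // addr0. Qed.

Lemma qpoch_sqr_pchar2 (q : R) m n : qpoch (q ^+ 2) m n = qpoch q m n ^+ 2.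
Proof.
rewrite /qpoch -prodrXl; apply: eq_bigr => i _.
by rewrite !(oppr_pchar2 char2) sqrD_pchar2 expr1n exprAC.
Qed.

End CharacteristicTwo.

Section CharacteristicTwoPolynomials.

Variable R : comNzRingType.
Hypothesis char2 : 2 \in [pchar R].
Implicit Types (p : {poly R}) (i m n : nat).

Let char2_poly : 2 \in [pchar {poly R}].
Proof. by rewrite pchar_poly. Qed.

Lemma euler_cube_pchar2 n :
  eqmodX n.+1 (\sum_(0 <= m < n.+1.*2) 'X^(triangular m)) (euler R n.+1 ^+ 3).
Proof.
set psi := \sum_(0 <= m < _) _; set E := euler R n.+1.
set P := partition_series R n.+1.
have EP : eqmodX n.+1 (E * P) 1 := @euler_mul_partition_series R n.+1.
have E_psi : eqmodX n.+1 (E * psi) (E ^+ 4).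
  apply: (@eqmodX_trans _ _ _ (euler R n.+1.*2 * psi)).
    apply/eqmodXMr/eqmodX_sym; apply: eqmodX_leq (leqnSn _) _.
    by apply: euler_stable; rewrite -addnn leq_addr.
  rewrite (exprM E 2 2) -qpoch_sqr_pchar2 //.
  apply: eqmodX_leq (euler_mul_triangular R (ltn0Sn n)).
  by rewrite ltnW // ltnS -addnn leq_addr.
apply: eqmodX_trans (eqmodX_mul_exp1 1 _ EP).
rewrite (_ : E ^+ 3 * _ = P * E ^+ 4); last ring.
apply: eqmodX_trans (eqmodXMl _ E_psi).
rewrite (_ : P * _ = psi * (E * P) ^+ 1); last ring.
exact/eqmodX_sym/eqmodX_mul_exp1.
Qed.

Lemma coef_sqr_pchar2 p i : (p ^+ 2)`_i = if odd i then 0 else p`_(i./2) ^+ 2.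
Proof.
elim/poly_ind: p i => [|p c IHp] i.
  by rewrite expr0n !coef0 expr0n if_same.
rewrite sqrD_pchar2 // exprMn -polyC_exp coefD coefMXn coefC coefD coefMX coefC.
by case: i => [|[|i]] //=; rewrite ?add0r ?addr0 // subn2 IHp negbK.
Qed.

Lemma has_parity_sqr p : has_parity false (p ^+ 2).
Proof. by move=> i; rewrite coef_sqr_pchar2; case: odd. Qed.

Lemma coef_double_odd_part_mul n m (E P psi_odd psi_even : {poly R}) :
  has_parity true psi_odd -> has_parity false psi_even ->
  eqmodX n (E * P) 1 -> eqmodX n (psi_odd + psi_even) (E ^+ 3) ->
  (m.*2 < n)%N -> E`_m = 0 -> (psi_odd * P)`_(m.*2) = 0.
Proof.
set psi := psi_odd + psi_even => odd_o even_e EP psiE lt_mn Em0.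
have psi_P2 : eqmodX n (psi * P ^+ 2) E.
  apply: eqmodX_trans (eqmodXMr _ psiE) _.
  by rewrite (_ : _ * _ = E * (E * P) ^+ 2); [apply: eqmodX_mul_exp1 | ring].
have psi_P4 : eqmodX n (psi * (P ^+ 2) ^+ 2) P.
  apply: eqmodX_trans (eqmodXMr _ psiE) _.
  by rewrite (_ : _ * _ = P * (E * P) ^+ 3); [apply: eqmodX_mul_exp1 | ring].
rewrite -(eqmodXMl psi_odd psi_P4 lt_mn).
have -> : psi_odd * (psi * (P ^+ 2) ^+ 2) =
    (psi_odd * P ^+ 2) ^+ 2 + psi_odd * psi_even * (P ^+ 2) ^+ 2.
  by rewrite /psi; ring.
have odd_oe := has_parityM odd_o even_e.
have odd_rest := has_parityM odd_oe (@has_parity_sqr (P ^+ 2)).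
rewrite coefD [X in _ + X]odd_rest ?odd_double // addr0.
rewrite coef_sqr_pchar2 odd_double doubleK.
suff -> : (psi_odd * P ^+ 2)`_m = 0 by rewrite expr0n.
have [odd_m | even_m] := boolP (odd m); last first.
  by apply: (has_parityM odd_o (@has_parity_sqr P)); rewrite (negbTE even_m).
have lt_m : (m < n)%N by lia.
have := psi_P2 _ lt_m; rewrite Em0 mulrDl coefD.
by rewrite [X in _ + X](has_parityM even_e (@has_parity_sqr P)) ?addr0 // odd_m.
Qed.

End CharacteristicTwoPolynomials.

Lemma coef_sum_Xn_mul_partition_series (R : comNzRingType) (I : finType)
    (Q : pred I) (e : I -> nat) n N : (n < N)%N ->
  ((\sum_(i | Q i) 'X^(e i)) * partition_series R N)`_n =
  (\sum_(i | Q i) (if e i <= n then partition_number (n - e i) else 0))%:R.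
Proof.
move=> lt_nN; rewrite mulr_suml coef_sum natr_sum; apply: eq_bigr => i _.
rewrite mulrC coefMXn coef_poly (leq_ltn_trans (leq_subr _ _) lt_nN).
by case: leqP.
Qed.

Lemma sigma_e_mex_double_mod4 m :
  ~ generalized_pentagonal m -> sigma_e_mex m.*2 = 0 %[mod 4].
Proof.
move=> m_pent; set n := m.*2; pose K := n.+1.*2.
have lt_nK : (n < K)%N by rewrite /K -addnn leq_addr.
rewrite (sigma_e_mex_mod4 lt_nK); set S := (\sum_(_ < _ | _) _)%N.
suff : (2 %| S)%N by lia.
have char2 := pchar_Fp (isT : prime 2).
rewrite (dvdn_pcharf char2) -(coef_sum_Xn_mul_partition_series _ _ _ (ltnSn n)).
have := @euler_cube_pchar2 _ char2 n; rewrite big_mkord.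
rewrite (bigID (fun i : 'I__ => odd (triangular i))) => cube; apply/eqP.
have EP := @euler_mul_partition_series 'F_2 n.+1.
apply: (coef_double_odd_part_mul char2 _ _ EP cube) => //.
- exact: has_parity_sum_Xn.
- by apply: has_parity_sum_Xn => i /negbTE.
- by apply: coef_euler_eq0; rewrite // /n; lia.
Qed.

Local Close Scope ring_scope.

Theorem theorem1p1 (n : nat) :
  sigma_e_mex (10 * n + 6) = 0 %[mod 4] /\ sigma_e_mex (10 * n + 8) = 0 %[mod 4].
Proof.
have -> : 10 * n + 6 = (5 * n + 3).*2 by lia.
have -> : 10 * n + 8 = (5 * n + 4).*2 by lia.
by split; apply: sigma_e_mex_double_mod4 => /generalized_pentagonal_mod5; lia.
Qed.
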